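(* Let $A$ be a commutative ring. Consider the following conditions: (1) $A$ is a weakly Arf ring. (2) For every $I \in \Lambda(A)$, there exists $a \in I$ such that $I^2 = aI$. Then the implication $(1) \Rightarrow (2)$ holds, and the converse holds if $A$ is Noetherian.
   Context: For a commutative ring $A$, $Q(A)$ denotes its total ring of fractions and $W(A)$ the set of non-zerodivisors on $A$; for an ideal $I$ of $A$, $\overline{I}$ denotes the integral closure of $I$ in $A$. $\Lambda(A) = \{\overline{(x)} \mid x \in W(A)\}$. $A$ is weakly Arf if $yz/x \in A$ whenever $x,y,z\in A$ are such that $x\in W(A)$ and $y/x, z/x \in Q(A)$ are integral over $A$. *)

(* Defs.v *)
From HB Require Import structures.
From mathcomp Require Import all_boot all_order all_algebra generic_quotient ring.
From mathcomp Require Import boolp classical_sets.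

Set Implicit Arguments.
Unset Strict Implicit.
Unset Printing Implicit Defensive.

Import GRing.Theory.
Local Open Scope ring_scope.
Local Open Scope classical_set_scope.

(* Rings are [comPzRingType]s, so the zero ring is allowed. This is why
   integrality is spelled out below instead of using [integralOver], which
   needs [nzRingType]s. Ideals are plain sets because mathcomp's [idealr] only
   covers proper ideals. *)

Definition nonzerodiv (A : comPzRingType) : set A :=
  [set x | forall y, x * y = 0 -> y = 0].
Arguments nonzerodiv : clear implicits.

Lemma nonzerodiv1 (A : comPzRingType) : nonzerodiv A 1.
Proof. by move=> y; rewrite mul1r. Qed.

Lemma nonzerodivM (A : comPzRingType) (x y : A) :
  nonzerodiv A x -> nonzerodiv A y -> nonzerodiv A (x * y).
Proof. by move=> Wx Wy z; rewrite -mulrA => /Wx /Wy. Qed.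

Lemma nonzerodivI (A : comPzRingType) (x : A) :
  nonzerodiv A x -> injective ( *%R x).
Proof.
by move=> Wx y z yz; apply/subr0_eq/Wx; rewrite mulrBr yz subrr.
Qed.

(* The total ring of fractions Q(A), built like mathcomp's [fraction] for
   integral domains: as denominators are non-zerodivisors, y/x = z/t iff
   y t = x z. *)
Module TotalFrac.
Section TotalFrac.
Variable A : comPzRingType.

Definition ratio : Type := {p : A * A | p.2 \in nonzerodiv A}.

Definition mk (y x : A) (Wx : nonzerodiv A x) : ratio :=
  exist (fun p : A * A => is_true (p.2 \in nonzerodiv A)) (y, x) (mem_set Wx).

Definition num (r : ratio) : A := (val r).1.
Definition den (r : ratio) : A := (val r).2.

Lemma denP (r : ratio) : nonzerodiv A (den r).
Proof. exact: set_mem (valP r). Qed.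
Arguments denP : clear implicits.

Definition equivf (r s : ratio) : bool := num r * den s == den r * num s.

Lemma equivf_refl : reflexive equivf.
Proof. by move=> r; rewrite /equivf mulrC. Qed.

Lemma equivf_sym : symmetric equivf.
Proof.
by move=> r s; rewrite /equivf eq_sym; congr (_ == _); rewrite mulrC.
Qed.

Lemma equivf_trans : transitive equivf.
Proof.
move=> s r t; rewrite /equivf mulrC => /eqP rs /eqP st.
apply/eqP; apply: (nonzerodivI (denP s)).
by rewrite mulrA rs -mulrA st mulrCA.
Qed.

Canonical equivf_equiv := EquivRel equivf equivf_refl equivf_sym equivf_trans.

Definition type := {eq_quot equivf}%qT.
HB.instance Definition _ : EqQuotient _ equivf type := EqQuotient.on type.
HB.instance Definition _ := Choice.on type.

Definition frac (y x : A) (Wx : nonzerodiv A x) : type := (\pi_type (mk y Wx))%qT.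

Definition tofrac (a : A) : type := frac a (@nonzerodiv1 A).

Lemma frac_eqP (y x z t : A) (Wx : nonzerodiv A x) (Wt : nonzerodiv A t) :
  frac y Wx = frac z Wt <-> y * t = x * z.
Proof.
rewrite /frac; split; first by move/eqmodP/eqP.
by move=> e; apply/eqmodP/eqP.
Qed.

Lemma fracP (q : type) :
  exists (y x : A) (Wx : nonzerodiv A x), q = frac y Wx.
Proof.
elim/quotW: q => -[[y x] /= Wx]; exists y, x, (set_mem Wx).
by apply/eqmodP; rewrite /= /equivf /num /den /= mulrC.
Qed.

Definition addf (r s : ratio) : ratio :=
  mk (num r * den s + num s * den r) (nonzerodivM (denP r) (denP s)).
Definition oppf (r : ratio) : ratio := mk (- num r) (denP r).
Definition mulf (r s : ratio) : ratio :=
  mk (num r * num s) (nonzerodivM (denP r) (denP s)).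

Definition add : type -> type -> type :=
  fun p q => (\pi_type (addf (repr p) (repr q)))%qT.
Definition opp : type -> type := fun p => (\pi_type (oppf (repr p)))%qT.
Definition mul : type -> type -> type :=
  fun p q => (\pi_type (mulf (repr p) (repr q)))%qT.

Lemma repr_frac (y x : A) (Wx : nonzerodiv A x) :
  num (repr (frac y Wx)) * x = den (repr (frac y Wx)) * y.
Proof.
by have /eqmodP/eqP := reprK (frac y Wx).
Qed.

Lemma add_frac (y x z t : A) (Wx : nonzerodiv A x) (Wt : nonzerodiv A t) :
  add (frac y Wx) (frac z Wt) = frac (y * t + z * x) (nonzerodivM Wx Wt).
Proof.
apply/frac_eqP.
have e1 := repr_frac y Wx; have e2 := repr_frac z Wt.
set r := repr (frac y Wx) in e1 *; set s := repr (frac z Wt) in e2 *.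
have -> : (num r * den s + num s * den r) * (x * t) =
  num r * x * (den s * t) + num s * t * (den r * x) by ring.
by rewrite e1 e2 /=; ring.
Qed.

Lemma opp_frac (y x : A) (Wx : nonzerodiv A x) : opp (frac y Wx) = frac (- y) Wx.
Proof. by apply/frac_eqP; rewrite mulNr mulrN repr_frac. Qed.

Lemma mul_frac (y x z t : A) (Wx : nonzerodiv A x) (Wt : nonzerodiv A t) :
  mul (frac y Wx) (frac z Wt) = frac (y * z) (nonzerodivM Wx Wt).
Proof. by apply/frac_eqP; rewrite mulrACA !repr_frac mulrACA. Qed.

Lemma addA : associative add.
Proof.
move=> p q r.
have [y1 [x1 [W1 ->]]] := fracP p; have [y2 [x2 [W2 ->]]] := fracP q.
have [y3 [x3 [W3 ->]]] := fracP r.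
by rewrite !add_frac; apply/frac_eqP; ring.
Qed.

Lemma addC : commutative add.
Proof.
move=> p q.
have [y1 [x1 [W1 ->]]] := fracP p; have [y2 [x2 [W2 ->]]] := fracP q.
by rewrite !add_frac; apply/frac_eqP; rewrite addrC mulrC [x1 * _]mulrC.
Qed.

Lemma add0 : left_id (tofrac 0) add.
Proof.
move=> p; have [y [x [Wx ->]]] := fracP p.
by rewrite add_frac; apply/frac_eqP; rewrite mul0r add0r mulr1 mul1r mulrC.
Qed.

Lemma addN : left_inverse (tofrac 0) opp add.
Proof.
move=> p; have [y [x [Wx ->]]] := fracP p.
by rewrite opp_frac add_frac; apply/frac_eqP; rewrite mulNr addNr mul0r mulr0.
Qed.

HB.instance Definition _ := GRing.isZmodule.Build type addA addC add0 addN.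

Lemma mulA : associative mul.
Proof.
move=> p q r.
have [y1 [x1 [W1 ->]]] := fracP p; have [y2 [x2 [W2 ->]]] := fracP q.
have [y3 [x3 [W3 ->]]] := fracP r.
by rewrite !mul_frac; apply/frac_eqP; rewrite mulrC !mulrA.
Qed.

Lemma mulC : commutative mul.
Proof.
move=> p q.
have [y1 [x1 [W1 ->]]] := fracP p; have [y2 [x2 [W2 ->]]] := fracP q.
by rewrite !mul_frac; apply/frac_eqP; rewrite mulrC [x2 * _]mulrC [y1 * _]mulrC.
Qed.

Lemma mul1 : left_id (tofrac 1) mul.
Proof.
move=> p; have [y [x [Wx ->]]] := fracP p.
by rewrite mul_frac; apply/frac_eqP; rewrite !mul1r mulrC.
Qed.

Lemma mulDl : left_distributive mul add.
Proof.
move=> p q r.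
have [y1 [x1 [W1 ->]]] := fracP p; have [y2 [x2 [W2 ->]]] := fracP q.
have [y3 [x3 [W3 ->]]] := fracP r.
rewrite add_frac !mul_frac add_frac; apply/frac_eqP.
ring.
Qed.

HB.instance Definition _ :=
  GRing.Zmodule_isComPzRing.Build type mulA mulC mul1 mulDl.

Lemma tofrac_is_zmod_morphism : zmod_morphism tofrac.
Proof.
move=> a b; rewrite -[RHS]/(add (tofrac a) (opp (tofrac b))) opp_frac add_frac.
by apply/frac_eqP; rewrite !mulr1 mul1r.
Qed.

Lemma tofrac_is_monoid_morphism : monoid_morphism tofrac.
Proof.
split=> // a b; rewrite -[RHS]/(mul (tofrac a) (tofrac b)) mul_frac.
by apply/frac_eqP; rewrite !mulr1 mul1r.
Qed.

HB.instance Definition _ := GRing.isZmodMorphism.Build A type tofrac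
  tofrac_is_zmod_morphism.
HB.instance Definition _ := GRing.isMonoidMorphism.Build A type tofrac
  tofrac_is_monoid_morphism.

Lemma tofrac_inj : injective tofrac.
Proof. by move=> a b /frac_eqP; rewrite mulr1 mul1r. Qed.

Lemma frac_mul_den (y x : A) (Wx : nonzerodiv A x) :
  frac y Wx * tofrac x = tofrac y.
Proof.
rewrite -[LHS]/(mul (frac y Wx) (tofrac x)) mul_frac.
by apply/frac_eqP; rewrite !mulr1 mulrC.
Qed.

End TotalFrac.
End TotalFrac.
HB.export TotalFrac.

Notation total_frac := TotalFrac.type.
Notation tfrac := TotalFrac.frac.
Notation to_tfrac := (@TotalFrac.tofrac _).

Definition integral_elt (A : comPzRingType) (q : total_frac A) : Prop :=
  exists (n : nat) (a : 'I_n -> A),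
    q ^+ n + \sum_(i < n) to_tfrac (a i) * q ^+ i = 0.

Definition weakly_arf (A : comPzRingType) : Prop :=
  forall (x y z : A) (Wx : nonzerodiv A x),
    integral_elt (tfrac y Wx) -> integral_elt (tfrac z Wx) ->
    exists a : A, tfrac (y * z) Wx = to_tfrac a.

Definition is_ideal (A : comPzRingType) (I : set A) : Prop :=
  [/\ I 0, forall x y, I x -> I y -> I (x + y) & forall a x, I x -> I (a * x)].

Definition ideal_gen (A : comPzRingType) (S : set A) : set A :=
  [set r | exists (n : nat) (c s : 'I_n -> A),
     (forall i, S (s i)) /\ r = \sum_(i < n) c i * s i].

Definition idealM (A : comPzRingType) (I J : set A) : set A :=
  ideal_gen [set x * y | x in I & y in J].

Definition idealX (A : comPzRingType) (I : set A) (n : nat) : set A :=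
  iter n (idealM I) setT.

(* The equation is r^n + a_1 r^(n-1) + ... + a_n = 0 with a_j in I^j; the
   coefficient a_j is [a i] with j = i + 1. *)
Definition integral_closure (A : comPzRingType) (I : set A) : set A :=
  [set r | exists (n : nat) (a : 'I_n -> A),
     (forall i : 'I_n, idealX I i.+1 (a i)) /\
     r ^+ n + \sum_(i < n) a i * r ^+ (n - i.+1) = 0].

Definition Lambda (A : comPzRingType) : set (set A) :=
  [set integral_closure (ideal_gen [set x]) | x in nonzerodiv A].
Arguments Lambda : clear implicits.

Definition noetherian (A : comPzRingType) : Prop :=
  forall I : set A, is_ideal I ->
    exists (n : nat) (s : 'I_n -> A), I = ideal_gen (range s).

(* Main.v *)
Require Import Defs.
From mathcomp Require Import all_boot all_algebra boolp classical_sets.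
From HB Require Import structures.
From mathcomp Require Import ring.

Set Implicit Arguments.
Unset Strict Implicit.
Unset Printing Implicit Defensive.

Import GRing.Theory.

Local Open Scope ring_scope.
Local Open Scope classical_set_scope.

(** Fix a non-zerodivisor x and let I be the integral closure of (x). Clearing
    denominators in an equation of integral dependence shows that y lies in I
    exactly when y/x is integral over A ([integral_closure_gen1P]). Since the
    integral elements of Q(A) are closed under sums and products
    ([integral_eltDM]), I is an ideal.

    (1) => (2): one can take a = x. If y and z lie in I, the weakly Arf
    condition gives yz = xw with w in A, and w/x = (y/x)(z/x) is integral, so
    w lies in I ([weakly_arf_integral_closure_sqr]).

    (2) => (1): suppose I^2 = aI with a in I. As x^2 lies in aI, a is a
    non-zerodivisor, and B = {w/a | w in I} is a subring of Q(A) containing A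
    and x/a. Its element x/a has the inverse a/x, which is integral over A
    because a lies in I; an inverse that is integral over a ring containing
    the element lies in that ring, so a/x lies in B. If y/x and z/x are
    integral then y/a and z/a lie in B, and therefore
    yz/x = a (y/a)(z/a)(a/x) lies in aB = I. This is
    [dvd_mul_of_reduction], written out in A. *)

(** * Integral elements of the total ring of fractions *)

(** Over nontrivial rings, the equations with free lower coefficients agree
    with the monic polynomials of [integralOver]; this gives access to the
    closure properties of the latter. *)
Lemma integralOver_sumP (R K : comNzRingType) (f : {rmorphism R -> K}) (z : K) :
  integralOver f z <->
  exists (n : nat) (a : 'I_n -> R), z ^+ n + \sum_(i < n) f (a i) * z ^+ i = 0.
Proof.
split=> [[p mon_p /rootP pz0]|[n [a az0]]].
  exists (size p).-1, (fun i => p`_i).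
  rewrite -[RHS]pz0 horner_coef size_map_poly_id0; last first.
    by rewrite (monicP mon_p) rmorph1 oner_eq0.
  rewrite -[in RHS](@prednK (size p)) ?size_poly_gt0 ?monic_neq0 //.
  rewrite big_ord_recr /= addrC; congr (_ + _).
    by rewrite coef_map /= -[p`__]/(lead_coef p) (monicP mon_p) rmorph1 mul1r.
  by apply: eq_bigr => i _; rewrite coef_map.
pose q : {poly R} := \sum_(i < n) (a i)%:P * 'X^i.
have sz_q : (size q < size ('X^n : {poly R})%R)%N.
  rewrite size_polyXn ltnS; apply/leq_sizeP => j le_nj.
  rewrite coef_sum big1 // => i _; rewrite coefCM coefXn.
  by rewrite gtn_eqF ?mulr0 // (leq_trans (ltn_ord i)).
exists ('X^n + q).
  by rewrite monicE lead_coefDl // lead_coefXn.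
apply/rootP; rewrite -[RHS]az0 rmorphD /= map_polyXn hornerD hornerXn.
congr (_ + _); rewrite rmorph_sum horner_sum; apply: eq_bigr => i _.
by rewrite rmorphM /= map_polyC map_polyXn hornerM hornerC hornerXn.
Qed.

(** Over the zero ring, where [integralOver] does not make sense, every element
    of Q(A) is 0. *)
Lemma integral_eltDM (A : comPzRingType) (p q : total_frac A) :
  integral_elt p -> integral_elt q -> integral_elt (p + q) /\ integral_elt (p * q).
Proof.
have [A0|A0] := eqVneq (1 : A) 0.
  have Q0 (r : total_frac A) : r = 0.
    by rewrite -[r]mul1r -[1]/(to_tfrac 1) A0 rmorph0 mul0r.
  by rewrite (Q0 p) (Q0 q) (Q0 (_ + _)) (Q0 (_ * _)).
have Q0 : 1 != 0 :> total_frac A.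
  apply: contra_neq A0 => e; apply: (@TotalFrac.tofrac_inj A).
  by rewrite rmorph1 rmorph0.
pose R : comNzRingType := HB.pack A (GRing.PzSemiRing_isNonZero.Build A A0).
pose K : comNzRingType := HB.pack (total_frac A)
  (GRing.PzSemiRing_isNonZero.Build (total_frac A) Q0).
pose f : {rmorphism R -> K} := to_tfrac : {rmorphism A -> total_frac A}.
move=> /(integralOver_sumP f) ip /(integralOver_sumP f) iq.
by split; apply/(integralOver_sumP f); [apply: integral_add|apply: integral_mul].
Qed.

Lemma integral_elt_tofrac (A : comPzRingType) (a : A) : integral_elt (to_tfrac a).
Proof.
exists 1%N, (fun=> - a); rewrite big_ord1 expr1 expr0 mulr1 rmorphN.
exact: subrr.
Qed.

(** The equation for y/x of degree n, multiplied by x^n. It characterises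
    integrality inside A, since x becomes invertible in Q(A). *)
Lemma integral_tfracP (A : comPzRingType) (x y : A) (Wx : nonzerodiv A x) :
  integral_elt (tfrac y Wx) <->
  exists (n : nat) (c : 'I_n -> A),
    y ^+ n + \sum_(i < n) c i * x ^+ (n - i) * y ^+ i = 0.
Proof.
have xV n : tfrac 1 Wx ^+ n * to_tfrac x ^+ n = 1.
  by rewrite -exprMn TotalFrac.frac_mul_den rmorph1 expr1n.
have key n (c : 'I_n -> A) :
    (tfrac y Wx ^+ n + \sum_(i < n) to_tfrac (c i) * tfrac y Wx ^+ i)
      * to_tfrac x ^+ n
    = to_tfrac (y ^+ n + \sum_(i < n) c i * x ^+ (n - i) * y ^+ i).
  rewrite mulrDl -exprMn TotalFrac.frac_mul_den rmorphD rmorphXn.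
  congr (_ + _); rewrite mulr_suml rmorph_sum; apply: eq_bigr => i _.
  rewrite !rmorphM !rmorphXn /= -(TotalFrac.frac_mul_den y Wx) exprMn.
  have -> : to_tfrac x ^+ n = to_tfrac x ^+ (n - i) * to_tfrac x ^+ i.
    by rewrite -exprD subnK // ltnW.
  by ring.
split=> -[n [c e]]; exists n, c.
  by apply: (@TotalFrac.tofrac_inj A); rewrite -key e mul0r rmorph0.
rewrite -[LHS]mulr1 -(xV n) mulrA mulrAC key e rmorph0.
exact: mul0r.
Qed.

(** * Generated ideals and their powers *)

Lemma mem_ideal_gen (A : comPzRingType) (S : set A) : S `<=` ideal_gen S.
Proof.
move=> r Sr; exists 1%N, (fun=> 1), (fun=> r); split=> //.
by rewrite big_ord1 mul1r.
Qed.

Lemma ideal_gen_sub (A : comPzRingType) (S J : set A) :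
  is_ideal J -> S `<=` J -> ideal_gen S `<=` J.
Proof.
move=> [J0 JD JM] SJ _ [n [c [s [Ss ->]]]].
by elim/big_ind: _ => // i _; apply/JM/SJ.
Qed.

Lemma is_ideal_scale (A : comPzRingType) (a : A) (I : set A) :
  is_ideal I -> is_ideal [set a * x | x in I].
Proof.
move=> [I0 ID IM]; split; first by exists 0; rewrite ?mulr0.
  by move=> _ _ [u Iu <-] [v Iv <-]; exists (u + v); rewrite ?mulrDr //; apply: ID.
by move=> b _ [u Iu <-]; exists (b * u); rewrite 1?mulrCA //; apply: IM.
Qed.

Lemma ideal_gen_id (A : comPzRingType) (I : set A) : is_ideal I -> ideal_gen I = I.
Proof.
by move=> idI; apply/seteqP; split; [apply: ideal_gen_sub|apply: mem_ideal_gen].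
Qed.

Lemma is_ideal_setT (A : comPzRingType) : is_ideal (@setT A).
Proof. by []. Qed.

Lemma ideal_gen1 (A : comPzRingType) (x : A) :
  ideal_gen [set x] = [set x * c | c in setT].
Proof.
apply/seteqP; split.
  apply: ideal_gen_sub; first exact/is_ideal_scale/is_ideal_setT.
  by move=> _ ->; exists 1; rewrite ?mulr1.
move=> _ [c _ <-]; exists 1%N, (fun=> c), (fun=> x).
by split=> //; rewrite big_ord1 mulrC.
Qed.

Lemma idealX_gen1 (A : comPzRingType) (x : A) (n : nat) :
  idealX (ideal_gen [set x]) n = [set x ^+ n * c | c in setT].
Proof.
elim: n => [|n IHn].
  by apply/seteqP; split=> // c _; exists c; rewrite ?mul1r.
rewrite [LHS]/(idealM _ (idealX _ n)) IHn; apply/seteqP; split.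
  apply: ideal_gen_sub; first exact/is_ideal_scale/is_ideal_setT.
  rewrite ideal_gen1 => _ [_ [c _ <-]] [_ [d _ <-]] <-.
  by exists (c * d); rewrite // exprS; ring.
move=> _ [c _ <-]; apply: mem_ideal_gen; exists x.
  exact: mem_ideal_gen.
by exists (x ^+ n * c); [exists c|rewrite mulrA exprS].
Qed.

(** [idealX I 2] unfolds to I (I A); the inner factor is absorbed by I. *)
Lemma idealX2 (A : comPzRingType) (I : set A) :
  is_ideal I -> idealX I 2 = ideal_gen [set y * z | y in I & z in I].
Proof.
move=> idI; have [_ _ IM] := idI; congr (idealM I _).
rewrite -[RHS]ideal_gen_id //; congr ideal_gen; apply/seteqP; split.
  by move=> _ [y Iy [c _ <-]]; rewrite mulrC; apply: IM.
by move=> y Iy; exists y => //; exists 1; rewrite ?mulr1.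
Qed.

(** * Integral closures of principal ideals *)

(** The coefficients of an integral dependence over (x) are multiples of
    powers of x, so this is the homogeneous equation of [integral_tfracP], whose
    coefficients are numbered in the opposite order. *)
Lemma integral_closure_gen1P (A : comPzRingType) (x : A) (Wx : nonzerodiv A x)
    (y : A) :
  integral_closure (ideal_gen [set x]) y <-> integral_elt (tfrac y Wx).
Proof.
rewrite integral_tfracP; split=> -[n].
  move=> [a [aX e]].
  have /choice[c cE] (i : 'I_n) : exists c, a i = x ^+ i.+1 * c.
    by have := aX i; rewrite idealX_gen1 => -[c _ <-]; exists c.
  exists n, (fun i => c (rev_ord i)).
  rewrite -[RHS]e (reindex_inj rev_ord_inj) /=; congr (_ + _).
  by apply: eq_bigr => i _; rewrite cE rev_ordK subKn // [c i * _]mulrC.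
move=> [c e]; exists n, (fun i => c (rev_ord i) * x ^+ i.+1); split=> [i|].
  by rewrite idealX_gen1; exists (c (rev_ord i)); rewrite // mulrC.
rewrite -[RHS]e [in RHS](reindex_inj rev_ord_inj) /=; congr (_ + _).
by apply: eq_bigr => i _; rewrite subKn.
Qed.

Lemma integral_closure_gen1_self (A : comPzRingType) (x : A) :
  nonzerodiv A x -> integral_closure (ideal_gen [set x]) x.
Proof.
move=> Wx; apply/(integral_closure_gen1P Wx)/integral_tfracP.
by exists 1%N, (fun=> -1); rewrite big_ord1 /=; ring.
Qed.

Lemma is_ideal_integral_closure_gen1 (A : comPzRingType) (x : A) :
  nonzerodiv A x -> is_ideal (integral_closure (ideal_gen [set x])).
Proof.
move=> Wx; have closP := integral_closure_gen1P Wx.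
have IM a y : integral_closure (ideal_gen [set x]) y ->
    integral_closure (ideal_gen [set x]) (a * y).
  move=> /closP iy; apply/closP.
  have -> : tfrac (a * y) Wx = to_tfrac a * tfrac y Wx.
    rewrite [RHS]TotalFrac.mul_frac; apply/TotalFrac.frac_eqP; ring.
  by have [] := integral_eltDM (integral_elt_tofrac a) iy.
split=> //.
  by rewrite -(mul0r x); apply/IM/integral_closure_gen1_self.
move=> y z /closP iy /closP iz; apply/closP.
have -> : tfrac (y + z) Wx = tfrac y Wx + tfrac z Wx.
  rewrite [RHS]TotalFrac.add_frac; apply/TotalFrac.frac_eqP; ring.
by have [] := integral_eltDM iy iz.
Qed.

(** The weakly Arf condition only puts yz/x in A. That it is again in I comes
    from (yz/x)/x = (y/x)(z/x), a product of integral elements. *)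
Lemma weakly_arf_integral_closure_sqr (A : comPzRingType) (x : A) :
  weakly_arf A -> nonzerodiv A x ->
  let I := integral_closure (ideal_gen [set x]) in
  idealX I 2 = [set x * w | w in I].
Proof.
move=> arfA Wx I; have idI := is_ideal_integral_closure_gen1 Wx.
rewrite idealX2 //; apply/seteqP; split.
  apply: ideal_gen_sub; first exact: is_ideal_scale.
  move=> _ [y /(integral_closure_gen1P Wx) iy] [z /(integral_closure_gen1P Wx) iz] <-.
  have [w /TotalFrac.frac_eqP] := arfA x y z Wx iy iz.
  rewrite mulr1 => yzE; exists w => //.
  apply/(integral_closure_gen1P Wx).
  have -> : tfrac w Wx = tfrac y Wx * tfrac z Wx.
    rewrite [RHS]TotalFrac.mul_frac; apply/TotalFrac.frac_eqP.
    by rewrite yzE; ring.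
  by have [] := integral_eltDM iy iz.
move=> _ [w Iw <-]; apply: mem_ideal_gen.
exists x; first exact: integral_closure_gen1_self.
by exists w.
Qed.

(** The products of elements of I being in aI makes B = I/a closed under
    multiplication, and the last hypothesis says that a/x, the inverse of the
    element x/a of B, is integral over A. Hence a/x is a polynomial in x/a, so
    it lies in B, and x divides yz. *)
Lemma dvd_mul_of_reduction (A : comPzRingType) (I : set A) (x a : A) :
    nonzerodiv A a -> I a -> I x ->
    (forall y z, I y -> I z -> exists2 w, I w & y * z = a * w) ->
    (exists (n : nat) (c : 'I_n -> A),
       a ^+ n + \sum_(i < n) c i * x ^+ (n - i) * a ^+ i = 0) ->
  forall y z, I y -> I z -> exists t, y * z = x * t.
Proof.
move=> Wa Ia Ix IIa [n [c e]] y z Iy Iz.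
have [v Iv yzE] := IIa _ _ Iy Iz.
(* Division by a: [g u] is x u / a, and [h u] is v u / a. *)
have /choice[g gP] u : exists u', I u -> I u' /\ x * u = a * u'.
  have [Iu|nIu] := pselect (I u); last by exists 0.
  by have [u' Iu' ->] := IIa _ _ Ix Iu; exists u'.
have /choice[h hP] u : exists s, I u -> v * u = a * s.
  have [Iu|nIu] := pselect (I u); last by exists 0.
  by have [s _ ->] := IIa _ _ Iv Iu; exists s.
(* [w k] is a (x/a)^k: it stays in I because x/a is in the ring I/a. *)
pose w k := iter k g a.
have Iw k : I (w k) by elim: k => //= k IHk; have [] := gP _ IHk.
have wS k : x * w k = a * w k.+1 by have [] := gP _ (Iw k).
have wX k : a * x ^+ k = a ^+ k * w k.
  elim: k => [|k IHk]; first by rewrite !expr0 mulrC.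
  by rewrite exprSr mulrA IHk -mulrA [w k * x]mulrC wS exprSr mulrA.
have vw k : v * w k.+1 = x * h (w k).
  by apply: (nonzerodivI Wa) => /=; rewrite mulrCA -wS mulrCA (hP _ (Iw k)) mulrCA.
have WaX k : nonzerodiv A (a ^+ k).
  by elim: k => [|k IHk]; rewrite ?expr0 ?exprS;
     [apply: nonzerodiv1|apply: nonzerodivM].
(* The equation of a over x, times a: in Q(A) it says that
   1 = - \sum_(i < n) c_i (x/a)^(n-i). *)
have aE : a = - \sum_(i < n) c i * w (n - i)%N.
  apply: (nonzerodivI (WaX n)) => /=; apply/eqP.
  rewrite mulrN -addr_eq0; apply/eqP; rewrite -[RHS](mul0r a) -[in RHS]e mulrDl.
  congr (_ + _); rewrite mulr_suml mulr_sumr; apply: eq_bigr => i _.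
  have -> : a ^+ n = a ^+ (n - i) * a ^+ i by rewrite -exprD subnK // ltnW.
  transitivity (c i * (a ^+ (n - i) * w (n - i)%N) * a ^+ i); first by ring.
  by rewrite -wX; ring.
(* In yz = a v, each term v w_(n-i) of the expansion of a is a multiple of x,
   because n - i > 0. *)
exists (- \sum_(i < n) c i * h (w (n - i.+1)%N)).
rewrite yzE {1}aE mulrN mulNr; congr (- _); rewrite mulr_suml mulr_sumr.
apply: eq_bigr => i _; rewrite mulrCA -vw -subSn // subSS; ring.
Qed.

Theorem theorem2p4 (A : comPzRingType) :
  let cond1 := weakly_arf A in
  let cond2 := forall I : set A, Lambda A I ->
    exists a : A, I a /\ idealX I 2 = [set a * x | x in I] in
  (cond1 -> cond2) /\ (noetherian A -> cond2 -> cond1).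
Proof.
move=> cond1 cond2; split=> [arfA _ [x Wx <-]|_ sqrI x y z Wx iy iz].
  exists x; split; first exact: integral_closure_gen1_self.
  exact: weakly_arf_integral_closure_sqr.
have closP := integral_closure_gen1P Wx.
have [|a [Ia I2E]] := sqrI (integral_closure (ideal_gen [set x])).
  by exists x.
set I := integral_closure _ in Ia I2E closP.
have Ix : I x := integral_closure_gen1_self Wx.
have IIa u v : I u -> I v -> exists2 w, I w & u * v = a * w.
  move=> Iu Iv; have : [set a * w | w in I] (u * v).
    rewrite -I2E idealX2; last exact: is_ideal_integral_closure_gen1.
    by apply: mem_ideal_gen; exists u => //; exists v.
  by case=> w Iw <-; exists w.
(* x * x is a non-zerodivisor and a multiple of a. *)
have Wa : nonzerodiv A a.
  move=> w aw0; have [b _ xxE] := IIa _ _ Ix Ix.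
  by apply: (nonzerodivM Wx Wx); rewrite xxE mulrAC aw0 mul0r.
have /closP/integral_tfracP a_over_x := Ia.
have [t yzE] := dvd_mul_of_reduction Wa Ia Ix IIa a_over_x
  (proj2 (closP y) iy) (proj2 (closP z) iz).
by exists t; apply/TotalFrac.frac_eqP; rewrite mulr1.
Qed.
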